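(* Let $G$ be a finite abelian group of order $n\ge 2$. If there exists an $(n,2;k_1,k_2;\ell)$-RWEDF in $G$, then $\ell\ge\sqrt{2/(n-1)}$.
   Context: $G$ is written additively, $G^*=G\setminus\{0\}$. For pairwise disjoint nonempty subsets $A_1,\dots,A_m$ of $G$ and $\delta\in G^*$, let $N_i(\delta)=|\{(a_i,a_j): a_i\in A_i,\ a_j\in A_j \text{ for some } j\neq i,\ a_i-a_j=\delta\}|$. An $(n,m;k_1,\dots,k_m;\ell)$-RWEDF is a collection of pairwise disjoint subsets with $|A_i|=k_i$ such that $\sum_i \frac{1}{k_i}N_i(\delta)=\ell$ for all $\delta\in G^*$. *)

(* Defs.v *)
From HB Require Import structures.
From mathcomp Require Export all_boot all_order all_algebra.

Set Implicit Arguments.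
Unset Strict Implicit.
Unset Printing Implicit Defensive.

Import Order.TTheory GRing.Theory Num.Theory.
Local Open Scope ring_scope.

Definition ext_diff_pairs (G : finZmodType) (m : nat) (A : 'I_m -> {set G})
    (i : 'I_m) (delta : G) : {set G * G} :=
  [set p : G * G | [&& p.1 \in A i,
                       [exists j : 'I_m, (j != i) && (p.2 \in A j)]
                     & p.1 - p.2 == delta]].

(* N_i(delta) *)
Definition Ndiff (G : finZmodType) (m : nat) (A : 'I_m -> {set G})
    (i : 'I_m) (delta : G) : nat := #|ext_diff_pairs A i delta|.

(* (n, m; k_1, ..., k_m; l)-RWEDF. The A_i are required to be nonempty, so
   every k_i is positive and the reciprocals 1 / k_i are genuine. *)
Definition is_RWEDF (R : rcfType) (G : finZmodType) (n m : nat)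
    (k : m.-tuple nat) (l : R) (A : 'I_m -> {set G}) : Prop :=
  [/\ #|G| = n,
      forall i : 'I_m, A i != set0,
      forall i j : 'I_m, i != j -> [disjoint A i & A j],
      forall i : 'I_m, #|A i| = tnth k i
    & forall delta : G, delta != 0 ->
        \sum_(i < m) (1 / (tnth k i)%:R) * (Ndiff A i delta)%:R = l].

(* Main.v *)
Require Import Defs.
From mathcomp Require Import all_boot all_order all_algebra.
From mathcomp Require Import ring lra.

Import Order.TTheory GRing.Theory Num.Theory.
Local Open Scope ring_scope.

(** Summing the defining identity over all nonzero differences gives
    [(n - 1) l = k1 + k2], so [l > 0].  Hence every nonzero element is an external
    difference of [A_1] or [A_2], and counting these differences gives
    [n - 1 <= 2 k1 k2].  By AM-GM, [(k1 + k2)^2 >= 4 k1 k2 >= 2 (n - 1)], that is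
    [l^2 >= 2 / (n - 1)]. *)

(** A zero difference would put one element in two disjoint blocks; hence sums over all of [G] may
    drop [d = 0]. *)
Lemma Ndiff0 (G : finZmodType) (m : nat) (A : 'I_m -> {set G}) (i : 'I_m) :
  (forall i j : 'I_m, i != j -> [disjoint A i & A j]) -> Ndiff A i 0 = 0%N.
Proof.
move=> dA; apply/eqP; rewrite cards_eq0; apply/eqP/setP=> -[x y].
rewrite !inE /= subr_eq0; apply/and3P => -[xAi /existsP[j /andP[ji yAj]] /eqP xy].
by rewrite -xy (disjointFl (dA _ _ ji) xAi) in yAj.
Qed.

(** Each pair in the product of [A i] with the union of the other blocks has exactly one difference,
    so the fibres of subtraction partition that product. *)
Lemma sum_Ndiff (G : finZmodType) (m : nat) (A : 'I_m -> {set G}) (i : 'I_m) :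
  (\sum_(d : G) Ndiff A i d)%N = (#|A i| * #|\bigcup_(j | j != i) A j|)%N.
Proof.
rewrite -cardsX -sum1_card (partition_big (fun p : G * G => p.1 - p.2) predT) //=.
apply: eq_bigr => d _; rewrite /Ndiff -sum1_card; apply: eq_bigl => -[x y].
rewrite !inE /= andbA; congr (_ && _ && _).
by apply/existsP/bigcupP => [[j /andP[ji yj]]|[j ji yj]]; exists j; rewrite ?ji.
Qed.

Lemma sum_Ndiff_neq0 (G : finZmodType) (m : nat) (A : 'I_m -> {set G}) (i : 'I_m) :
  (forall i j : 'I_m, i != j -> [disjoint A i & A j]) ->
  (\sum_(d : G | d != 0%R) Ndiff A i d)%N =
  (#|A i| * #|\bigcup_(j | j != i) A j|)%N.
Proof. by move=> dA; rewrite -sum_Ndiff [RHS](bigD1 0) //= Ndiff0. Qed.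

Lemma card_neq0 (G : finZmodType) : #|[pred d : G | d != 0]| = #|G|.-1.
Proof. by rewrite -(cardC1 (0 : G)); apply: eq_card. Qed.

Theorem mainTheorem7 (R : rcfType) (G : finZmodType) (n k1 k2 : nat) (l : R)
    (hG : #|G| = n) (hn : (2 <= n)%N) :
  (exists A : 'I_2 -> {set G}, is_RWEDF n [tuple k1; k2] l A) ->
  l >= Num.sqrt (2 / (n%:R - 1)).
Proof.
case=> A [_ A0 dA cA sA].
have c0 : #|A ord0| = k1 by rewrite cA.
have c1 : #|A ord_max| = k2 by rewrite cA.
have k1_gt0 : (0 < k1)%N by rewrite -c0 card_gt0.
have k2_gt0 : (0 < k2)%N by rewrite -c1 card_gt0.
have S0 : (\sum_(d : G | d != 0%R) Ndiff A ord0 d = k1 * k2)%N.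
  (* In ['I_2] the only index other than [ord0] is [ord_max], so the union is a single block. *)
  rewrite sum_Ndiff_neq0 // c0 (big_pred1 ord_max) ?c1 // => j.
  by case: j => -[|[]].
have S1 : (\sum_(d : G | d != 0%R) Ndiff A ord_max d = k2 * k1)%N.
  rewrite sum_Ndiff_neq0 // c1 (big_pred1 ord0) ?c0 // => j.
  by case: j => -[|[]].
have lE (d : G) : d != 0 ->
    k1%:R^-1 * (Ndiff A ord0 d)%:R + k2%:R^-1 * (Ndiff A ord_max d)%:R = l.
  move=> /sA <-; rewrite big_ord_recr big_ord1 /= !div1r.
  by rewrite (_ : widen_ord _ _ = ord0) //; apply: val_inj.
have k1R : 0 < k1%:R :> R by rewrite ltr0n.
have k2R : 0 < k2%:R :> R by rewrite ltr0n.
have sumE : (k1 + k2)%:R = l * n.-1%:R :> R.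
  (* Sum [lE] over the nonzero [d]: the weights [1/k1] and [1/k2] each cancel one factor of
     [k1 * k2], leaving [k2 + k1]. *)
  rewrite mulr_natr -hG -card_neq0 -sumr_const -(eq_bigr _ lE) big_split /=.
  rewrite -!mulr_sumr -!natr_sum S0 S1 !natrM !natrD.
  by rewrite !mulKf ?gt_eqF // addrC.
have n1R : 0 < n.-1%:R :> R by rewrite ltr0n -subn1 subn_gt0.
have l_gt0 : 0 < l.
  by rewrite -(pmulr_lgt0 _ n1R) -sumE ltr0n addn_gt0 k1_gt0.
have n1_le : (n.-1 <= k1 * k2 + k2 * k1)%N.
  rewrite -hG -card_neq0 -S0 -S1 -big_split /= -sum1_card.
  (* Each nonzero [d] contributes at least 1: if both counts vanished, [lE] would give [l = 0]. *)
  apply: leq_sum => d d0; rewrite lt0n addn_eq0; apply/negP => /andP[/eqP N0 /eqP N1].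
  by move: l_gt0; rewrite -(lE _ d0) N0 N1 !mulr0 addr0 ltxx.
have -> : n%:R - 1 = n.-1%:R :> R by rewrite -{1}(ltn_predK hn) -natr1 addrK.
rewrite -(ger0_norm (ltW l_gt0)) -sqrtr_sqr ler_wsqrtr // ler_pdivrMr //.
(* A second factor [n.-1] completes the square [(l * n.-1) ^+ 2], which [sumE] identifies. *)
rewrite -(ler_pM2r n1R) (_ : l ^+ 2 * _ * _ = (k1 + k2)%:R ^+ 2); last first.
  by rewrite sumE; ring.
move: n1_le; rewrite -(ler_nat R) !natrD !natrM => n1_le.
(* AM-GM in the form [(k1 + k2)^2 = (k1 - k2)^2 + 4 k1 k2]. *)
have := sqr_ge0 (k1%:R - k2%:R : R).
by nra.
Qed.
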